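(* Let $X=c_0$ or $X=\ell_p$ with $p\in[1,+\infty]$, regarded as an algebra with the coordinatewise product. Then $Z(X)$ is maximal algebrable; that is, $Z(X)\cup\{0\}$ contains an algebra with a system of generators of cardinality $\dim(X)$.
   Context: All sequence spaces are over $\mathbb{C}$. For a sequence space $X$, $Z(X)$ denotes the set of all sequences in $X$ having only finitely many zero coordinates. $\dim(X)$ is the algebraic (Hamel) dimension of $X$ as a vector space (for the spaces in the statement it is the cardinality of the continuum). A system of generators of an algebra $\mathcal{C}$ is a subset $S\subset\mathcal{C}$ such that the subalgebra generated by $S$, i.e. the linear span of all finite (nonempty) products of elements of $S$, is $\mathcal{C}$. A subset $\mathcal{B}$ of a Banach algebra $\mathcal{A}$ is called algebrable if there is a subalgebra $\mathcal{C}$ of $\mathcal{A}$ with $\mathcal{C}\subset\mathcal{B}\cup\{0\}$ such that the cardinality of any system of generators of $\mathcal{C}$ is infinite. *)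

(* Defs.v *)
From HB Require Import structures.
From mathcomp Require Import all_boot all_order all_algebra.
From mathcomp Require Import all_classical all_reals all_analysis.
From mathcomp Require Import complex.

Set Implicit Arguments.
Unset Strict Implicit.
Unset Printing Implicit Defensive.

Import Order.TTheory GRing.Theory Num.Theory.
Import numFieldNormedType.Exports.

Local Open Scope classical_set_scope.
Local Open Scope card_scope.
Local Open Scope ring_scope.

Definition lin_span (K : fieldType) (V : lmodType K) (A : set V) : set V :=
  [set u | exists n (a : 'I_n -> K) (x : 'I_n -> V),
     (forall i, A (x i)) /\ u = \sum_(i < n) a i *: x i].

Definition lin_indep (K : fieldType) (V : lmodType K) (A : set V) : Prop :=
  forall n (x : 'I_n -> V), injective x -> (forall i, A (x i)) ->
  forall a : 'I_n -> K, \sum_(i < n) a i *: x i = 0 -> forall i, a i = 0.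

Definition hamel_basis (K : fieldType) (V : lmodType K) (X H : set V) : Prop :=
  [/\ H `<=` X, lin_indep H & lin_span H = X].

(* The cardinality of S is the algebraic dimension of the subspace X. *)
Definition card_eq_dim (T : Type) (K : fieldType) (V : lmodType K)
    (S : set T) (X : set V) : Prop :=
  exists2 H : set V, hamel_basis X H & S #= H.

(* Complex sequences with pointwise operations.  The codomain is R[i]^o, and
   not R[i], so that scaling is by complex numbers: R[i] itself is an
   lmodType over R. *)
Notation cseq R := (nat -> R[i]^o).

Section sequence_algebras.
Variable R : realType.
Implicit Types (X B C S : set (cseq R)).

Definition c0 : set (cseq R) := [set u : cseq R | u @ \oo --> (0 : R[i]^o)].

Definition ell (p : \bar R) : set (cseq R) :=
  [set u : cseq R |
    (Lnorm counting p (fun n => (ComplexField.Normc.normc (u n))%:E) < +oo)%E].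

Definition Zset X : set (cseq R) :=
  [set u | X u /\ finite_set [set n | u n = 0]].

(* Subalgebras need not contain the unit sequence (which is not in c0). *)
Definition subalgebra C : Prop :=
  GRing.submod_closed [in C] /\ GRing.mulr_2closed [in C].

Definition finite_products S : set (cseq R) :=
  [set u | exists n (x : 'I_n.+1 -> cseq R),
     (forall i, S (x i)) /\ u = \prod_(i < n.+1) x i].

Definition system_of_generators S C : Prop :=
  S `<=` C /\ lin_span (finite_products S) = C.

(* The existence of one system of generators of cardinality dim X would by
   itself be nearly void, since C generates itself.  As in the definition of
   algebrability, the requirement bears on every system of generators. *)
Definition maximal_algebrable X B : Prop :=
  exists C, [/\ subalgebra C,
    C `<=` B `|` [set 0],
    exists2 S, system_of_generators S C & card_eq_dim S X &
    forall S, system_of_generators S C -> infinite_set S /\ card_eq_dim S X].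

End sequence_algebras.
Arguments c0 R : clear implicits.

(* Main.v *)
Require Import Defs.
From mathcomp Require Import all_boot all_order all_algebra.
From mathcomp Require Import all_classical all_reals all_analysis.
From mathcomp Require Import ess_sup_inf complex lra.

Set Implicit Arguments.
Unset Strict Implicit.
Unset Printing Implicit Defensive.

Import Order.TTheory GRing.Theory Num.Theory.
Import numFieldNormedType.Exports.

Local Open Scope classical_set_scope.
Local Open Scope card_scope.
Local Open Scope ring_scope.

(** The algebra is the linear span of the geometric sequences (q ^ n)_n with
    ratio 0 < q <= 1/2.  These sequences decay fast enough to lie in every space
    at hand, and the product of two of them is again one of them, so their span
    is a subalgebra.  A nontrivial combination of geometric sequences with
    distinct positive ratios is equivalent at infinity to its term of largest
    ratio, hence has only finitely many zeros (sum_geom_finite_zeros); the same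
    fact shows that these sequences are linearly independent.

    For the number of generators, the point of bounding the ratios by 1/2 is
    that a product of two admissible ratios is at most 1/4.  A ratio in
    ]1/4, 1/2] is thus indecomposable: if it occurred in the expansion of no
    element of a generating set S, then S would generate a subalgebra avoiding
    it (generators_cover).  There are continuum many such ratios, and each
    element of S takes care of finitely many of them, so the continuum embeds
    into S x nat.  A diagonal argument in the style of Koenig removes the factor
    nat (card_cantor_diagonal), without cardinal arithmetic.

    Conversely the set of all complex sequences has the cardinality of the
    continuum (card_cseq_le), and a Hamel basis of X extending the independent
    geometric sequences (hamel_basis_exists) has at least that cardinality.  So S
    and the basis are both equipotent to the Cantor set nat -> bool. *)

(** * Linear spans and Hamel bases *)

Section Span.
Variables (K : fieldType) (V : lmodType K).
Implicit Types (A X : set V).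

(** Lists of pairs (coefficient, index) can be concatenated and mapped over,
    unlike the families indexed by ordinals in the definition of the span. *)
Lemma lin_span_imageP (I : eqType) (e : I -> V) (G : set I) (u : V) :
  lin_span (e @` G) u <->
  exists2 s : seq (K * I), (forall p, p \in s -> G p.2) &
    u = \sum_(p <- s) p.1 *: e p.2.
Proof.
split=> [[n [a [x [xG ->]]]]|[s sG ->]].
  have /choice[g gP] : forall i, exists j, G j /\ e j = x i.
    by move=> i; have [j Gj ej] := xG i; exists j.
  exists [seq (a i, g i) | i <- enum 'I_n].
    by move=> p /mapP[i _ ->]; have [] := gP i.
  rewrite big_map big_enum; apply: eq_bigr => i _ /=.
  by have [_ ->] := gP i.
exists (size s), (fun i => (tnth (in_tuple s) i).1).
exists (fun i => e (tnth (in_tuple s) i).2); split.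
  by move=> i; exists (tnth (in_tuple s) i).2 => //; apply/sG/mem_tnth.
by rewrite big_tnth.
Qed.

(** Collecting the terms of equal index: the asymptotics of a sum of geometric
    sequences can be read off only when the ratios are distinct. *)
Lemma lin_span_image_uniq (I : eqType) (e : I -> V) (G : set I) (u : V) :
  lin_span (e @` G) u ->
  exists (r : seq I) (a : I -> K),
    [/\ uniq r, (forall i, i \in r -> G i) & u = \sum_(i <- r) a i *: e i].
Proof.
move=> /lin_span_imageP[s sG ->].
exists (undup [seq p.2 | p <- s]), (fun i => \sum_(p <- s | p.2 == i) p.1).
split; first exact: undup_uniq.
  by move=> i; rewrite mem_undup => /mapP[p ps ->]; apply: sG.
under [RHS]eq_bigr do rewrite scaler_suml.
rewrite (exchange_big_dep predT)//= big_seq [RHS]big_seq.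
apply: eq_bigr => p ps.
rewrite (big_rem p.2) /=; last by rewrite mem_undup map_f.
rewrite eqxx big_seq_cond big1 ?addr0// => i.
rewrite rem_filter ?undup_uniq// mem_filter => /andP[/andP[/= + _] /eqP pi].
by rewrite pi eqxx.
Qed.

Lemma lin_spanE A u : lin_span A u <->
  exists2 s : seq (K * V), (forall p, p \in s -> A p.2) &
    u = \sum_(p <- s) p.1 *: p.2.
Proof. by rewrite -{1}(image_id A) lin_span_imageP. Qed.

Lemma sub_lin_span A : A `<=` lin_span A.
Proof.
move=> u Au; apply/lin_spanE; exists [:: (1, u)].
  by move=> p; rewrite inE => /eqP ->.
by rewrite big_seq1 scale1r.
Qed.

Lemma lin_span_closed A : GRing.submod_closed [in lin_span A].
Proof.
split.
  by rewrite inE; apply/lin_spanE; exists [::]; rewrite ?big_nil.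
move=> a u v; rewrite !inE => /lin_spanE[s sA ->] /lin_spanE[t tA ->].
apply/lin_spanE; exists ([seq (a * p.1, p.2) | p <- s] ++ t).
  move=> p; rewrite mem_cat => /orP[/mapP[q qs ->]|]; last exact: tA.
  exact: sA q qs.
rewrite big_cat big_map scaler_sumr; congr (_ + _).
by apply: eq_bigr => p _; rewrite scalerA.
Qed.

Lemma lin_span_sub A X : GRing.submod_closed [in X] -> A `<=` X ->
  lin_span A `<=` X.
Proof.
move=> [X0 Xl] AX u /lin_spanE[s sA ->].
elim: s sA => [|p s IHs] sA; first by rewrite big_nil; move: X0; rewrite inE.
rewrite big_cons; have := Xl p.1 p.2 (\sum_(q <- s) q.1 *: q.2).
rewrite !inE; apply; first by apply/AX/sA/mem_head.
by apply: IHs => q qs; apply: sA; rewrite inE qs orbT.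
Qed.

Lemma lin_indepP A : lin_indep A <->
  forall (r : seq V) (a : V -> K), uniq r -> (forall v, v \in r -> A v) ->
    \sum_(v <- r) a v *: v = 0 -> forall v, v \in r -> a v = 0.
Proof.
split=> [indA r a r_uniq rA sum0 v vr|indA n x xinj xA a sum0 i].
  have /tnthP[i ->] : v \in in_tuple r by [].
  apply: (indA _ (tnth (in_tuple r)) _ _ (fun i => a (tnth (in_tuple r) i))).
  - exact/tuple_uniqP.
  - by move=> j; apply/rA/mem_tnth.
  - by rewrite -(big_tnth _ _ r xpredT (fun v => a v *: v)).
have aE j : (\sum_(k < n | x k == x j) a k) = a j.
  by rewrite (big_pred1 j)// => k; rewrite /= (inj_eq xinj).
rewrite -aE; apply: (indA (codom x) (fun v => \sum_(k < n | x k == v) a k)).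
- by rewrite map_inj_uniq ?enum_uniq.
- by move=> v /codomP[j ->].
- rewrite big_map big_enum /= -[RHS]sum0.
  by apply: eq_bigr => j _; rewrite aE.
- exact: codom_f.
Qed.

Lemma lin_indep_image (I : eqType) (e : I -> V) (G : set I) :
  (forall (r : seq I) (a : I -> K), uniq r -> (forall i, i \in r -> G i) ->
    \sum_(i <- r) a i *: e i = 0 -> forall i, i \in r -> a i = 0) ->
  lin_indep (e @` G).
Proof.
move=> indG; apply/lin_indepP => r a r_uniq rA.
have [s rE sG] : exists2 s, r = [seq e i | i <- s] & forall i, i \in s -> G i.
  elim: r rA {r_uniq} => [|v r IHr] rA; first by exists [::].
  have [i Gi eiv] := rA v (mem_head _ _).
  have [|s rs sG] := IHr; first by move=> w wr; apply: rA; rewrite inE wr orbT.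
  by exists (i :: s); rewrite /= ?eiv ?rs// => j; rewrite inE => /predU1P[->|/sG].
rewrite rE big_map => sum0 v /mapP[i si ->].
apply: (indG s (fun i => a (e i))) => //.
by apply: (@map_uniq _ _ e); rewrite -rE.
Qed.

(** Zorn's lemma is applied to the sets B such that E `|` B is independent, and
    not to the independent sets containing E, so that the empty chain needs no
    separate treatment. *)
Lemma hamel_basis_exists X E : GRing.submod_closed [in X] -> E `<=` X ->
  lin_indep E -> exists2 H, hamel_basis X H & E `<=` H.
Proof.
move=> Xsub EX indE.
pose P (B : set V) := B `<=` X /\ lin_indep (E `|` B).
have [F FP Ftot|B [[BX indB] Bmax]] := @Zorn_bigcup V P.
  split; first by move=> v [B FB Bv]; have [+ _] := FP _ FB; apply.
  apply/lin_indepP => r a r_uniq rA.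
  (* A finite subfamily of the union already lives in one member of the chain. *)
  suff [|[B FB rB]] : (forall v, v \in r -> E v) \/
      exists2 B, F B & (forall v, v \in r -> (E `|` B) v).
  - by move=> rE; have /lin_indepP := indE; apply.
  - by have [_ /lin_indepP] := FP _ FB; apply.
  elim: r rA {r_uniq} => [|v r IHr] rA; first by left.
  have {}IHr : (forall v, v \in r -> E v) \/
      exists2 B, F B & (forall v, v \in r -> (E `|` B) v).
    by apply: IHr => w wr; apply: rA; rewrite inE wr orbT.
  have [Ev|[B FB Bv]] := rA v (mem_head _ _).
    case: IHr => [rE|[C FC rC]].
      by left=> w; rewrite inE => /predU1P[->|/rE].
    by right; exists C => // w; rewrite inE => /predU1P[->|/rC//]; left.
  right; case: IHr => [rE|[C FC rC]].
    by exists B => // w; rewrite inE => /predU1P[->|/rE]; [right|left].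
  have [BC|CB] := Ftot _ _ FB FC.
    by exists C => // w; rewrite inE => /predU1P[->|/rC//]; right; apply: BC.
  exists B => // w; rewrite inE => /predU1P[->|/rC[Ew|/CB Bw]].
  - by right.
  - by left.
  - by right.
exists (E `|` B); last by left.
have HX : E `|` B `<=` X by rewrite subUset.
split=> //; apply/seteqP; split; first exact: lin_span_sub.
move=> x Xx; apply: contrapT => nx.
have xB : ~ B x by move=> Bx; apply/nx/sub_lin_span; right.
have xE : ~ E x by move=> Ex; apply/nx/sub_lin_span; left.
apply: (Bmax (x |` B)).
  split; last by move=> h; apply/xB/h; left.
  by right.
split; first by rewrite subUset; split=> // _ ->.
have {}indB := (lin_indepP _).1 indB.
apply/lin_indepP => r a r_uniq rA sum0.
have rH v : v \in r -> v != x -> (E `|` B) v.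
  move=> vr vx; have [|[/eqP|]] := rA v vr; first by left.
    by rewrite (negPf vx).
  by right.
have [xr|xr] := boolP (x \in r); last first.
  by apply: indB => // v vr; apply: rH => //; apply: contraNneq xr => <-.
rewrite (big_rem x xr)/= rem_filter// in sum0.
have rx v : v \in [seq y <- r | predC1 x y] -> (E `|` B) v.
  by rewrite mem_filter => /andP[/= vx vr]; apply: rH.
have [ax0|ax0] := eqVneq (a x) 0.
  rewrite ax0 scale0r add0r in sum0 => v vr.
  have [->//|vx] := eqVneq v x.
  apply: (indB _ a _ rx sum0); first exact: filter_uniq.
  by rewrite mem_filter /= vx.
exfalso; apply: nx; apply/lin_spanE.
exists [seq (- (a x)^-1 * a v, v) | v <- [seq y <- r | predC1 x y]].
  by move=> p /mapP[v vr ->]; apply: rx.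
rewrite big_map /=; under eq_bigr do rewrite -scalerA.
rewrite -scaler_sumr; move/eqP: sum0; rewrite addrC addr_eq0 => /eqP ->.
by rewrite scalerN scaleNr opprK scalerA mulVf// scale1r.
Qed.

End Span.

(** * Cardinality of the continuum *)

Lemma card_le_injection (T U : Type) (A : set T) (B : set U) (f : T -> U) :
  (forall x, A x -> B (f x)) -> {in A &, injective f} -> A #<= B.
Proof.
move=> fAB finj; rewrite -(card_le_eql (inj_card_eq finj)).
by apply: subset_card_le => _ [x Ax <-]; apply: fAB.
Qed.

(** If for every n the points sent to level n missed some value b_n at their n-th
    coordinate, the sequence (b_n) would lie in no level.  So for some n the
    n-th coordinates of level n exhaust nat -> bool, and choosing a preimage of
    each value embeds nat -> bool into S. *)
Lemma card_cantor_diagonal (T : Type) (S : set T)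
    (f : (nat -> nat -> bool) -> T * nat) :
  injective f -> (forall x, S (f x).1) -> [set: nat -> bool] #<= S.
Proof.
move=> finj fS.
have [n surj_n] : exists n, forall b, exists2 x, (f x).2 = n & x n = b.
  apply: contrapT => /forallNP noN.
  have /choice[x xP] : forall n, exists b, forall x, (f x).2 = n -> x n <> b.
    move=> n; have /existsNP[b nb] := noN n; exists b => x fx xn.
    by apply: nb; exists x.
  exact: (xP (f x).2 x).
have /choice[g gP] : forall b, exists x, (f x).2 = n /\ x n = b.
  by move=> b; have [x] := surj_n b; exists x.
apply: (@card_le_injection _ _ _ _ (fun b => (f (g b)).1)) => [b _|b c _ _ fbc].
  exact: fS.
have [[fb gb] [fc gc]] := (gP b, gP c).
rewrite -gb -gc; congr (_ n); apply: finj.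
by rewrite [LHS]surjective_pairing [RHS]surjective_pairing fbc fb fc.
Qed.

Lemma card_cantor_prod_nat (T : Type) (S : set T) (f : (nat -> bool) -> T * nat) :
  injective f -> (forall b, S (f b).1) -> [set: nat -> bool] #<= S.
Proof.
move=> finj fS.
pose code (x : nat -> nat -> bool) k :=
  if unpickle k is Some mn then x mn.1 mn.2 else false.
apply: (@card_cantor_diagonal _ S (f \o code)) => [|x]; last exact: fS.
apply: inj_comp finj _ => x y xy; apply/funext => m; apply/funext => n.
by have := congr1 (@^~ (pickle (m, n))) xy; rewrite /code /= pickleK.
Qed.

Section CantorSet.
Variable R : realType.

(** A complex sequence is determined by the rational cuts of the real and
    imaginary parts of its terms, which are countably many bits. *)
Lemma card_cseq_le (X : set (cseq R)) : X #<= [set: nat -> bool].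
Proof.
pose part (z : R[i]) (b : bool) := if b then complex.Re z else complex.Im z.
pose cut (u : cseq R) (k : nat) : bool :=
  if unpickle k is Some (n, q, b) then ratr q < part (u n) b else false.
apply: (@card_le_injection _ _ _ _ cut) => // u v _ _ uv.
have parts n b : part (u n) b = part (v n) b.
  have cutE q : (ratr q < part (u n) b) = (ratr q < part (v n) b).
    by have := congr1 (@^~ (pickle (n, q, b))) uv; rewrite /cut pickleK.
  apply/eqP; rewrite eq_le; apply/andP; split; rewrite leNgt; apply/negP.
    move=> /rat_in_itvoo[q]; rewrite in_itv /= => /andP[vq].
    by rewrite cutE => /(lt_trans vq); rewrite ltxx.
  move=> /rat_in_itvoo[q]; rewrite in_itv /= => /andP[uq].
  by rewrite -cutE => /(lt_trans uq); rewrite ltxx.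
apply/funext => n; apply/eqP; rewrite eq_complex.
by apply/andP; split; apply/eqP; [exact: (parts n true)|exact: (parts n false)].
Qed.

(** Partial sums for the embedding of the Cantor set into the reals.  The digits
    are 0 and 1: in base 3 the tail after a digit weighs at most half of it, so
    distinct digit sequences already have distinct sums. *)
Definition ternary_sum (b : nat -> bool) (n : nat) : R :=
  \sum_(i < n) (b i)%:R / 3 ^+ i.

Lemma ternary_sumD b k m :
  ternary_sum b (k + m) <= ternary_sum b k + 3 / 2 * (3 ^- k - 3 ^- (k + m)).
Proof.
elim: m => [|m IHm]; first by rewrite addn0 subrr mulr0 addr0.
rewrite addnS /ternary_sum big_ord_recr /=.
have p0 : 0 < (3 : R) ^- (k + m) by rewrite invr_gt0 exprn_gt0.
have -> : (3 : R) ^- (k + m).+1 = 3^-1 * 3 ^- (k + m) by rewrite exprS invfM.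
move: IHm; rewrite /ternary_sum.
by case: (b _); rewrite ?mul1r ?mul0r; lra.
Qed.

Lemma ternary_sum_homo b m n : (m <= n)%N -> ternary_sum b m <= ternary_sum b n.
Proof.
move=> /subnKC <-; elim: (n - m)%N => [|k IHk]; first by rewrite addn0.
rewrite addnS /ternary_sum big_ord_recr /=; apply: (le_trans IHk).
by rewrite lerDl divr_ge0// exprn_ge0.
Qed.

Lemma ternary_sum_ub b k n : ternary_sum b n <= ternary_sum b k + 3 / 2 * 3 ^- k.
Proof.
have p0 m : 0 < (3 : R) ^- m by rewrite invr_gt0 exprn_gt0.
have [kn|/ltnW nk] := leqP k n.
  rewrite -(subnKC kn); apply: le_trans (ternary_sumD _ _ _) _.
  by have := p0 (k + (n - k))%N; lra.
apply: (le_trans (ternary_sum_homo b nk)); have := p0 k; lra.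
Qed.

Definition ternary (b : nat -> bool) : R := sup (range (ternary_sum b)).

Lemma has_sup_ternary b : has_sup (range (ternary_sum b)).
Proof.
split; first by exists (ternary_sum b 0); exists 0%N.
by exists (ternary_sum b 0 + 3 / 2 * 3 ^- 0) => _ [n _ <-]; apply: ternary_sum_ub.
Qed.

Lemma ternary_ge b n : ternary_sum b n <= ternary b.
Proof. by apply: ub_le_sup; [exact: (has_sup_ternary b).2 | exists n]. Qed.

Lemma ternary_le b k : ternary b <= ternary_sum b k + 3 / 2 * 3 ^- k.
Proof.
apply: ge_sup; first exact: (has_sup_ternary b).1.
by move=> _ [n _ <-]; apply: ternary_sum_ub.
Qed.

Lemma ternary_itv b : 0 <= ternary b <= 3 / 2.
Proof.
apply/andP; split.
  by have := ternary_ge b 0; rewrite /ternary_sum big_ord0.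
by have := ternary_le b 0; rewrite /ternary_sum big_ord0 expr0 invr1 mulr1 add0r.
Qed.

(** At the first place k where two sequences differ, the digit 1 adds 3 ^- k,
    and all the later digits of the other sequence add at most half of that. *)
Lemma ternary_inj : injective ternary.
Proof.
move=> b c; apply: contra_eq => /eqP bc.
have /ex_minnP[k bk kmin] : exists k, b k != c k.
  by apply: contrapT => /forallNP h; apply/bc/funext => k; apply/eqP/negPn/negP/h.
suff gtr (x y : nat -> bool) : ternary_sum x k = ternary_sum y k -> x k -> ~~ y k ->
    ternary y < ternary x.
  have bck : ternary_sum b k = ternary_sum c k.
    apply: eq_bigr => i _; suff -> : b i = c i by [].
    by apply/eqP; apply: contraTT (ltn_ord i) => /kmin; rewrite -leqNgt.
  have [bk1|bk0] := boolP (b k); have [ck1|ck0] := boolP (c k).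
  - by rewrite bk1 ck1 in bk.
  - by rewrite gt_eqF// gtr.
  - by rewrite lt_eqF// gtr.
  - by rewrite (negPf bk0) (negPf ck0) in bk.
move=> xy xk yk; apply: le_lt_trans (ternary_le y k.+1) _.
apply: lt_le_trans (ternary_ge x k.+1).
rewrite /ternary_sum !big_ord_recr /= -/(ternary_sum x k) -/(ternary_sum y k) xy.
rewrite xk (negPf yk) mul0r mul1r exprS invfM.
have : 0 < (3 : R) ^- k by rewrite invr_gt0 exprn_gt0.
lra.
Qed.

End CantorSet.

(** * Combinations of geometric sequences *)

Section GeometricSequences.
Variable R : realType.

Definition geom (q : R) : cseq R := fun n => (q ^+ n)%:C%C.

(** After division by m ^ n, where m is the largest ratio with a nonzero
    coefficient, the sum converges to the coefficient of m. *)
Lemma exp_sum_finite_zeros (r : seq R) (a : R -> R) : uniq r ->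
  (forall q, q \in r -> 0 < q) -> (exists2 q, q \in r & a q != 0) ->
  finite_set [set n | \sum_(q <- r) a q * q ^+ n = 0].
Proof.
move=> r_uniq r_gt0 [q0 q0r aq0].
have [m mr [am mmax]] : exists2 m, m \in r &
    a m != 0 /\ forall q, q \in r -> a q != 0 -> q <= m.
  have /tnthP[i0 q0E] : q0 \in in_tuple r by [].
  rewrite q0E in aq0.
  case: (@arg_maxP _ _ _ i0 (fun i => a (tnth (in_tuple r) i) != 0)
    (tnth (in_tuple r)) aq0) => i ai imax.
  exists (tnth (in_tuple r) i); first exact: mem_tnth.
  split=> // q qr; have /tnthP[j ->] : q \in in_tuple r by [].
  exact: imax.
have m0 := r_gt0 m mr.
pose h n := \sum_(q <- r) a q * (q / m) ^+ n.
have hm : h @ \oo --> a m.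
  have -> : a m = \sum_(q <- r) (if q == m then a m else 0).
    rewrite -big_mkcond (big_rem m)//= eqxx rem_filter// big_filter_cond /=.
    by rewrite big1 ?addr0// => q /andP[/negPf ->].
  rewrite /h big_seq; under eq_fun do rewrite big_seq.
  apply: cvg_big => [|q qr]; first exact: add_continuous.
  have [->|qm] := eqVneq q m.
    rewrite divff ?gt_eqF//; under eq_fun do rewrite expr1n mulr1.
    exact: cvg_cst.
  have [->|aq] := eqVneq (a q) 0.
    by under eq_fun do rewrite mul0r; exact: cvg_cst.
  rewrite -(mulr0 (a q)); apply: cvgMr; apply: cvg_expr.
  have q_gt0 := r_gt0 q qr.
  rewrite gtr0_norm ?divr_gt0// ltr_pdivrMr// mul1r lt_neqAle qm.
  exact: mmax.
have [N _ hN] := cvgr_neq0 _ hm am.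
apply: (@sub_finite_set _ _ `I_N) => [n /= sum0|]; last exact: finite_II.
rewrite ltnNge; apply/negP => /hN /eqP; apply.
have /eqP : m ^+ n * h n = 0.
  rewrite -[RHS]sum0 mulr_sumr; apply: eq_bigr => q _.
  by rewrite expr_div_n mulrCA [X in _ * X]mulrCA mulfV ?mulr1// expf_neq0// gt_eqF.
by rewrite mulf_eq0 expf_eq0 (gt_eqF m0) andbF => /eqP.
Qed.

Lemma sum_geomE (r : seq R) (a : R -> R[i]) n :
  (\sum_(q <- r) a q *: geom q) n = \sum_(q <- r) a q * (q ^+ n)%:C%C.
Proof.
by elim: r => [|q r IHr]; rewrite ?big_nil// !big_cons -IHr.
Qed.

(** A nonzero complex coefficient has a nonzero real or imaginary part, and the
    zeros of the sum are zeros of both parts: the real case suffices. *)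
Lemma sum_geom_finite_zeros (r : seq R) (a : R -> R[i]) : uniq r ->
  (forall q, q \in r -> 0 < q) -> (exists2 q, q \in r & a q != 0) ->
  finite_set [set n | (\sum_(q <- r) a q *: geom q) n = 0].
Proof.
move=> r_uniq r_gt0 [q qr aq].
have [Req|Imq] : complex.Re (a q) != 0 \/ complex.Im (a q) != 0.
  by apply/orP; rewrite -negb_and; move: aq; rewrite eq_complex.
- have := exp_sum_finite_zeros (a := fun p => complex.Re (a p)) r_uniq r_gt0
    (ex_intro2 _ _ q qr Req).
  apply: sub_finite_set => n /=.
  rewrite sum_geomE => /(congr1 (@complex.Re R)) /= h.
  rewrite -[RHS]h raddf_sum; apply: eq_bigr => p _.
  by case: (a p) => x y /=; rewrite mulr0 subr0.
- have := exp_sum_finite_zeros (a := fun p => complex.Im (a p)) r_uniq r_gt0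
    (ex_intro2 _ _ q qr Imq).
  apply: sub_finite_set => n /=.
  rewrite sum_geomE => /(congr1 (@complex.Im R)) /= h.
  rewrite -[RHS]h raddf_sum; apply: eq_bigr => p _.
  by case: (a p) => x y /=; rewrite mulr0 add0r.
Qed.

Lemma sum_geom_eq0 (r : seq R) (a : R -> R[i]) : uniq r ->
  (forall q, q \in r -> 0 < q) -> \sum_(q <- r) a q *: geom q = 0 ->
  forall q, q \in r -> a q = 0.
Proof.
move=> r_uniq r_gt0 sum0 q qr; apply/eqP/negPn/negP => aq.
have : finite_set [set n | (\sum_(q <- r) a q *: geom q) n = 0].
  by apply: sum_geom_finite_zeros => //; exists q.
rewrite sum0 (_ : mkset _ = setT); first exact: infinite_nat.
by apply/seteqP; split.
Qed.

Lemma geom_inj : injective geom.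
Proof.
move=> p q pq; have := congr1 (fun u : cseq R => complex.Re (u 1)) pq.
by rewrite /= !expr1.
Qed.

Lemma geomM p q : geom p * geom q = geom (p * q).
Proof. by apply/funext => n; rewrite /geom exprMn rmorphM. Qed.

End GeometricSequences.

(** * Linear structure of the classical sequence spaces *)

Lemma le_Lnorm_counting (R : realType) (p : \bar R) (f g : nat -> R) : (1 <= p)%E ->
  (forall n, `|f n| <= `|g n|) ->
  (Lnorm counting p (EFin \o f) <= Lnorm counting p (EFin \o g))%E.
Proof.
case: p => [r||//] r1 fg.
  rewrite lee_fin in r1; have r0 : 0 < r by exact: lt_le_trans r1.
  rewrite !Lnorm_counting//.
  have homo_powe (s : R) (x y : \bar R) : 0 <= s -> (0 <= x)%E -> (x <= y)%E ->
      (x `^ s <= y `^ s)%E.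
    move=> s0 x0 xy; apply: gt0_ler_poweR => //; rewrite in_itv /= ?leey ?andbT//.
    by rewrite (le_trans x0).
  apply: (homo_powe); first by rewrite invr_ge0 ltW.
    by apply: nneseries_ge0 => n _ _; apply: poweR_ge0.
  apply: lee_nneseries => [n _ _|n _]; first exact: poweR_ge0.
  by apply: (homo_powe); rewrite ?lee_fin// ltW.
rewrite unlock; case: ifP => // _; apply: le_ess_sup.
by apply: nearW => n; rewrite /= lee_fin.
Qed.

Section SequenceSpaces.
Variable R : realType.
Implicit Types (u v : cseq R) (q : R).

Lemma c0_submod_closed : GRing.submod_closed [in c0 R].
Proof.
split; first by rewrite inE; exact: cvg_cst.
move=> a u v; rewrite !inE => u0 v0.
rewrite /c0 /= -[0]addr0 -{1}(scaler0 R[i]^o a).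
by apply: cvgD => //; apply: cvgZr.
Qed.

Lemma geom_c0 q : 0 < q < 1 -> c0 R (geom q).
Proof.
move=> /andP[q0 q1]; rewrite /c0 /=; apply/cvgrPdist_lt => /= e e0.
have eE : e = (complex.Re e)%:C%C by rewrite RRe_real// gtr0_real.
have Ree0 : 0 < complex.Re e by rewrite -ltcR -eE.
have qn0 : (GRing.exp q : R ^nat) @ \oo --> 0.
  by apply: cvg_expr; rewrite gtr0_norm.
move/cvgrPdist_lt/(_ _ Ree0): qn0; apply: filterS => n.
by rewrite !sub0r !normrN eE /geom normc_def /= expr0n addr0 sqrtr_sqr ltcR.
Qed.

(** Every function on nat being measurable, membership in ell p is that of the
    sequence of moduli in the real Lebesgue space of the counting measure. *)
Lemma ellE p u : ell p u <->
  (fun n => ComplexField.Normc.normc (u n)) \in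
    Lfun (counting : {measure set nat -> \bar R}) p.
Proof.
split=> [up|]; last by move=> /andP[_]; rewrite inE.
by apply/andP; split; rewrite inE//=.
Qed.

Lemma ell_submod_closed p : (1 <= p)%E -> GRing.submod_closed [in ell (R := R) p].
Proof.
move=> p1.
have [L0 Lp] :=
  Lfun_submod_closed (counting : {measure set nat -> \bar R}) p1.
split.
  rewrite inE; apply/ellE; rewrite (_ : (fun=> _) = 0)//.
  by apply/funext => n; rewrite ComplexField.Normc.normc0.
move=> a u v; rewrite !inE => /ellE up /ellE vp.
have /andP[_] := Lp (ComplexField.Normc.normc a) _ _ up vp.
rewrite inE /finite_norm /ell /=; apply: le_lt_trans.
have normc_ge0 (z : R[i]) : 0 <= ComplexField.Normc.normc z.
  by case: z => x y; exact: sqrtr_ge0.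
apply: le_Lnorm_counting => // n; rewrite ger0_norm//.
apply: le_trans (ler_norm _).
apply: le_trans (le_normcD (a * u n) (v n)) _.
by rewrite ComplexField.Normc.normcM.
Qed.

Lemma geom_ell p q : (1 <= p)%E -> 0 < q < 1 -> ell p (geom q).
Proof.
move=> p1 /andP[q0 q1].
have normq n : ComplexField.Normc.normc (geom q n) = q ^+ n.
  by rewrite /geom /= expr0n addr0 sqrtr_sqr ger0_norm// exprn_ge0// ltW.
have qn n : 0 < q ^+ n <= 1 by rewrite exprn_gt0//= exprn_ile1// ltW.
rewrite /ell /mkset (_ : (fun n => _) = EFin \o GRing.exp q); last first.
  by apply/funext => n; rewrite normq.
case: p p1 => [r||//] p1; last first.
  rewrite unlock; case: ifP => // _; apply: (@le_lt_trans _ _ 1%E); last exact: ltry.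
  apply/ess_supP; apply: nearW => n /=.
  by have /andP[qn0 qn1] := qn n; rewrite lee_fin gtr0_norm.
rewrite lee_fin in p1; rewrite Lnorm_counting ?(lt_le_trans _ p1)//.
apply: poweR_lty; apply: (@le_lt_trans _ _ (\sum_(k <oo) (q ^+ k)%:E)%E).
  apply: lee_nneseries => [n _ _|n _]; first exact: poweR_ge0.
  have /andP[qn0 _] := qn n.
  by rewrite /= lee_fin gtr0_norm// ge1r_powR.
rewrite (_ : (fun _ => _) = EFin \o series (geometric 1 q)).
  rewrite EFin_lim ?ltry//; apply: is_cvg_geometric_series.
  by rewrite gtr0_norm.
apply/funext => n /=; rewrite sumEFin.
by congr (_%:E); apply: eq_bigr => i _; rewrite /= mul1r.
Qed.

End SequenceSpaces.

(** * The algebra spanned by geometric sequences *)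

Section GeometricAlgebra.
Variable R : realType.
Implicit Types (A D S : set (cseq R)) (q t : R).

Lemma lin_span_mul A D : GRing.submod_closed [in D] ->
  (forall u v, A u -> A v -> D (u * v)) ->
  forall u v, lin_span A u -> lin_span A v -> D (u * v).
Proof.
move=> [D0 Dl] AD u v Au Av; rewrite !inE in D0.
have scalel (a : R[i]) (x y w : cseq R) :
    (a *: x + y) * w = a *: (x * w) + y * w.
  apply/funext => n; transitivity ((a * x n + y n) * w n) => //.
  by rewrite mulrDl -mulrA.
have mulD w : [set x | D (x * w)] 0 /\
    (forall (a : R[i]) (x y : cseq R), D (x * w) -> D (y * w) ->
      D ((a *: x + y) * w)).
  split; first by rewrite /= mul0r.
  by move=> a x y Dx Dy; have := Dl a (x * w) (y * w); rewrite !inE scalel; apply.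
have sub w : GRing.submod_closed [in [set x | D (x * w)]].
  have [? h] := mulD w; split; first by rewrite inE.
  by move=> a x y; rewrite !inE; apply: h.
apply: (lin_span_sub (sub v) _ Au) => x Ax /=; rewrite mulrC.
by apply: (lin_span_sub (sub x) _ Av) => y Ay /=; exact: AD.
Qed.

(** Stated for an arbitrary product-stable set, so as to bound the generated
    algebra from above both by itself and by spans of fewer sequences. *)
Lemma finite_products_sub S D : (forall u v, D u -> D v -> D (u * v)) ->
  S `<=` D -> finite_products S `<=` D.
Proof.
move=> DM SD u [n [x [xS ->]]]; elim: n x xS => [|n IHn] x xS.
  by rewrite big_ord_recl big_ord0 mulr1; exact/SD/xS.
by rewrite big_ord_recl; apply: DM; [exact/SD/xS | apply: IHn].
Qed.

Definition small_ratios : set R := [set q | 0 < q <= 2^-1].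

Lemma small_ratio p : 4^-1 < p <= 2^-1 -> small_ratios p.
Proof. by rewrite /small_ratios /=; lra. Qed.

Lemma small_ratio_lt1 p : small_ratios p -> 0 < p < 1.
Proof. by rewrite /small_ratios /=; lra. Qed.

(** The second bound is what makes the ratios above 1/4 indecomposable. *)
Lemma small_ratiosM p q : small_ratios p -> small_ratios q ->
  small_ratios (p * q) /\ p * q <= 4^-1.
Proof.
move=> /andP[p0 p2] /andP[q0 q2].
have pq : p * q <= 2^-1 * 2^-1 by rewrite ler_pM// ltW.
have pq0 : 0 < p * q by exact: mulr_gt0.
by split; rewrite /small_ratios /=; lra.
Qed.

(** The affine map carries [0, 3/2], which contains the ternary sums, into
    ]1/4, 1/2]. *)
Definition cantor_ratio (b : nat -> bool) : R := 3^-1 + ternary R b / 10.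

Lemma cantor_ratio_itv b : 4^-1 < cantor_ratio b <= 2^-1.
Proof. by have /andP[] := ternary_itv R b; rewrite /cantor_ratio; lra. Qed.

Lemma cantor_ratio_inj : injective cantor_ratio.
Proof. by move=> b c; rewrite /cantor_ratio => bc; apply: (@ternary_inj R); lra. Qed.

Definition geom_span (G : set R) : set (cseq R) := lin_span (@geom R @` G).

Lemma geom_span_mul (G H : set R) : (forall p q, G p -> G q -> H (p * q)) ->
  forall u v, geom_span G u -> geom_span G v -> geom_span H (u * v).
Proof.
move=> GH; apply: lin_span_mul; first exact: lin_span_closed.
move=> _ _ [p Gp <-] [q Gq <-]; rewrite geomM; apply/sub_lin_span.
by exists (p * q) => //; apply: GH.
Qed.

(** By linear independence, a geometric sequence lies in the span of others only
    if it is one of them. *)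
Lemma geom_spanE (G : set R) t : G `<=` [set q | 0 < q] -> 0 < t ->
  geom_span G (geom t) -> G t.
Proof.
move=> G0 t0 /lin_span_image_uniq[r [a [r_uniq rG geomE]]].
apply: contrapT => Gt.
have tr : t \notin r by apply/negP => /rG.
pose b q := if q == t then -1 else a q.
have : b t = 0; last by rewrite /b eqxx => /eqP; rewrite oppr_eq0 oner_eq0.
apply: (@sum_geom_eq0 R (t :: r)).
- by rewrite /= tr.
- by move=> q; rewrite inE => /predU1P[->//|/rG/G0].
- rewrite big_cons /b eqxx scaleN1r geomE addrC; apply/eqP; rewrite subr_eq0.
  apply/eqP; apply: eq_big_seq => q qr.
  by case: eqVneq qr tr => // -> ->.
- exact: mem_head.
Qed.

(** Here f s lists the ratios occurring in some expansion of s.  If t is in no f s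
    with s in S, then S lies in the span of the sequences of admissible ratio
    different from t; no product of two admissible ratios being t, that span is
    an algebra, and it would contain the sequence of ratio t. *)
Lemma generators_cover S : system_of_generators S (geom_span small_ratios) ->
  exists f : cseq R -> seq R, forall t, 4^-1 < t <= 2^-1 ->
    exists2 s, S s & t \in f s.
Proof.
move=> [SC Sgen].
have /choice[f fP] : forall s : cseq R, exists l : seq (R[i] * R), S s ->
    (forall p, p \in l -> small_ratios p.2) /\ s = \sum_(p <- l) p.1 *: geom p.2.
  move=> s; have [Ss|nS] := pselect (S s); last by exists [::].
  by have /lin_span_imageP[l] := SC s Ss; exists l.
exists (fun s => [seq p.2 | p <- f s]) => t /andP[t4 t2].
apply: contrapT => nt.
pose G := [set q | small_ratios q /\ q <> t].
have : geom_span G (geom t).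
  have : geom_span small_ratios (geom t).
    by apply/sub_lin_span; exists t => //; apply: small_ratio; rewrite t4.
  rewrite -Sgen; apply: lin_span_sub; first exact: lin_span_closed.
  apply: finite_products_sub.
    apply: geom_span_mul => p q [Gp _] [Gq _].
    have [Gpq pq] := small_ratiosM Gp Gq; split=> // pqt.
    by rewrite -pqt ltNge pq in t4.
  move=> s Ss; have [fs sE] := fP s Ss; apply/lin_span_imageP.
  exists (f s) => // p ps; split; first exact: fs.
  by move=> pt; apply: nt; exists s => //; rewrite -pt; apply: map_f.
case/geom_spanE => //; first by move=> q [/andP[]].
by apply: lt_trans t4; rewrite invr_gt0.
Qed.

(** A ratio t is recovered from a generator s with t in the finite list f s
    and from the position of t in that list. *)
Lemma generators_card S : system_of_generators S (geom_span small_ratios) ->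
  [set: nat -> bool] #<= S.
Proof.
move=> /generators_cover[f fP].
have /choice[s sP] : forall b, exists s, S s /\ cantor_ratio b \in f s.
  by move=> b; have [s] := fP _ (cantor_ratio_itv b); exists s.
apply: (@card_cantor_prod_nat _ S (fun b => (s b, index (cantor_ratio b) (f (s b))))).
  move=> b c [sbc]; rewrite sbc => ibc; apply: cantor_ratio_inj.
  have [_ eb] := sP b; have [_ ec] := sP c; rewrite sbc in eb.
  by rewrite -(nth_index 0 eb) -(nth_index 0 ec) ibc.
by move=> b; have [] := sP b.
Qed.

End GeometricAlgebra.

(** All that matters about X is that it is a linear space containing the
    geometric sequences of ratio in ]0, 1[. *)
Lemma geom_span_maximal (R : realType) (X : set (cseq R)) :
  GRing.submod_closed [in X] -> (forall q : R, 0 < q < 1 -> X (geom q)) ->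
  maximal_algebrable X (Zset X).
Proof.
move=> Xsub Xgeom; pose C := geom_span (@small_ratios R).
have gX : @geom R @` (@small_ratios R) `<=` X.
  by move=> _ [q Gq <-]; apply/Xgeom/small_ratio_lt1.
have CX : C `<=` X by apply: lin_span_sub.
have CM u v : C u -> C v -> C (u * v).
  by apply: geom_span_mul => p q Gp Gq; have [] := small_ratiosM Gp Gq.
have [H HX gH] := hamel_basis_exists Xsub gX (lin_indep_image (fun r a ru rG =>
  sum_geom_eq0 ru (fun q qr => proj1 (andP (rG q qr))))).
have JH : [set: nat -> bool] #<= H.
  apply: card_le_trans (subset_card_le gH).
  apply: (@card_le_injection _ _ _ _ (fun b => geom (cantor_ratio R b))).
    move=> b _; exists (cantor_ratio R b) => //.
    exact/small_ratio/cantor_ratio_itv.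
  by move=> b c _ _ /geom_inj /cantor_ratio_inj.
have gen S : system_of_generators S C -> infinite_set S /\ card_eq_dim S X.
  move=> /generators_card JS; split.
    apply/infiniteP; apply: card_le_trans JS.
    apply: (@card_le_injection _ _ _ _ (fun n m => n == m)) => // m n _ _.
    by move=> /(congr1 (@^~ n)); rewrite /= eqxx => /eqP.
  exists H => //; apply: Cantor_Bernstein.
    exact: card_le_trans (card_cseq_le S) JH.
  exact: card_le_trans (card_cseq_le H) JS.
have CC : system_of_generators C C.
  split=> //; apply/seteqP; split.
    apply: lin_span_sub; first exact: lin_span_closed.
    by apply: finite_products_sub.
  move=> u Cu; apply/sub_lin_span; exists 0, (fun=> u); split=> //.
  by rewrite big_ord_recl big_ord0 mulr1.
exists C; split=> //.
- by split; [exact: lin_span_closed | move=> u v; rewrite !inE; apply: CM].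
- move=> u Cu; have [r [a [r_uniq rG uE]]] := lin_span_image_uniq Cu.
  have [[q qr aq]|a0] := pselect (exists2 q, q \in r & a q != 0).
    left; split; first exact: CX.
    rewrite uE; apply: sum_geom_finite_zeros => //; last by exists q.
    by move=> p /rG/andP[].
  right; rewrite /= uE big_seq big1// => q qr.
  have [->|aq] := eqVneq (a q) 0; first by rewrite scale0r.
  by case: a0; exists q.
- by exists C => //; have [] := gen C CC.
Qed.

Theorem proposition2p1 (R : realType) (X : set (cseq R))
    (hX : X = c0 R \/ exists2 p : \bar R, (1 <= p)%E & X = ell p) :
  maximal_algebrable X (Zset X).
Proof.
case: hX => [->|[p p1 ->]]; apply: geom_span_maximal.
- exact: c0_submod_closed.
- exact: geom_c0.
- exact: ell_submod_closed.
- by move=> q; exact: geom_ell.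
Qed.
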